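(* For each integer $n \ge 1$, the Tutte polynomial $T_n(x,y)=T(G_n;x,y)$ of the Farey graph $G_n$ is given by $$T_n(x,y)=T_{1,n}(x,y)+T_{2,n}(x,y),$$ where the polynomials $T_{1,n}=T_{1,n}(x,y)$ and $T_{2,n}=T_{2,n}(x,y)$ (the contributions to the Tutte polynomial of the spanning subgraphs of $G_n$ in which the two special vertices lie in the same connected component, respectively in different connected components) satisfy the recursive relations $$T_{1,n}= y\,T_{1,n-1}^2 +\frac{2}{x-1}\,T_{1,n-1}T_{2,n-1}+\frac{1}{x-1}\,T_{2,n-1}^2,$$ $$T_{2,n}= T_{2,n-1}^2+2\,T_{1,n-1}T_{2,n-1},$$ with initial conditions $T_{1,0}(x,y)=1$ and $T_{2,0}(x,y)=x-1$. (The identities are understood in the field of rational functions in $x,y$.)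
   Context: Farey graphs. The Farey graphs $G_n$ ($n\ge 0$), each with two distinguished (''special'') vertices $X_n,Y_n$, are defined recursively. $G_0$ is a single edge joining its two special vertices $X_0$ and $Y_0$. For $n\ge 1$, take two disjoint copies $G_{n-1}^1,G_{n-1}^2$ of $G_{n-1}$, with special vertices $X_{n-1}^i,Y_{n-1}^i$ ($i=1,2$); identify $Y_{n-1}^1$ with $X_{n-1}^2$ into one vertex, and add a new edge $e_n$ joining $X_{n-1}^1$ and $Y_{n-1}^2$. The result is $G_n$, with special vertices $X_n=X_{n-1}^1$ and $Y_n=Y_{n-1}^2$. It has $2^n+1$ vertices and $2^{n+1}-1$ edges. Tutte polynomial. A spanning subgraph $H$ of a graph $G$ is a subgraph with $V(H)=V(G)$ and $E(H)\subseteq E(G)$. With $k(H)$ the number of connected components of $H$, the rank is $r(H)=|V(H)|-k(H)$ and the nullity is $n(H)=|E(H)|-r(H)$. The Tutte polynomial is $$T(G;x,y)=\sum_{H}(x-1)^{r(G)-r(H)}(y-1)^{n(H)},$$ the sum being over all spanning subgraphs $H$ of $G$. Partial sums. Let $G_{1,n}$ be the set of spanning subgraphs of $G_n$ in which $X_n$ and $Y_n$ belong to the same connected component, and $G_{2,n}$ the set of spanning subgraphs of $G_n$ in which $X_n$ and $Y_n$ belong to two different connected components. For $i=1,2$ and $n\ge0$ define $$T_{i,n}(x,y)=\sum_{H\in G_{i,n}}(x-1)^{r(G_n)-r(H)}(y-1)^{n(H)}.$$ *)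

(* Defs.v *)
From HB Require Import structures.
From mathcomp Require Import all_boot all_algebra.
From mathcomp Require Import mpoly.

Set Implicit Arguments.
Unset Strict Implicit.
Unset Printing Implicit Defensive.

Import GRing.Theory.
Local Open Scope ring_scope.

(* Finite undirected graphs, with the edges forming a type of their own; the  *)
(* order of the two endpoints of an edge is irrelevant.                       *)
Record graph := Graph {
  vertex : finType;
  edge : finType;
  ends : edge -> vertex * vertex
}.

Definition adj (G : graph) : rel (vertex G) :=
  [rel u v | [exists e : edge G, (ends e == (u, v)) || (ends e == (v, u))]].

Definition same_component (G : graph) (u v : vertex G) : bool :=
  connect (@adj G) u v.

Definition components (G : graph) : nat := n_comp (@adj G) (vertex G).

(* The truncated subtractions in this file are all exact: a graph has at most *)
(* as many components as vertices, at least #|V| - #|E| components, and at    *)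
(* most as many components as any of its spanning subgraphs.                  *)
Definition rank (G : graph) : nat := (#|vertex G| - components G)%N.

Definition nullity (G : graph) : nat := (#|edge G| - rank G)%N.

Definition spanning (G : graph) (H : {set edge G}) : graph :=
  @Graph (vertex G) {e : edge G | e \in H} (fun e => ends (val e)).

Definition polyxy : idomainType := {mpoly int[2]}.
Definition xpol : polyxy := 'X_(ord0 : 'I_2).
Definition ypol : polyxy := 'X_(ord_max : 'I_2).

Definition tutte_term (G : graph) (H : {set edge G}) : polyxy :=
  (xpol - 1) ^+ (rank G - rank (spanning H)) * (ypol - 1) ^+ nullity (spanning H).

Definition tutte (G : graph) : polyxy := \sum_(H : {set edge G}) tutte_term H.

Record special_graph := SpecialGraph {
  sgraph :> graph;
  sX : vertex sgraph;
  sY : vertex sgraph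
}.

Section FareyStep.

Variable G : special_graph.

(* Two copies of the vertices of G, with sX of the second copy left out       *)
(* because it is identified with sY of the first.                             *)
Definition step_vertex : finType :=
  (vertex G + {v : vertex G | v != sX G})%type.

Definition copy1 (v : vertex G) : step_vertex := inl v.

Definition copy2 (v : vertex G) : step_vertex :=
  if insub v is Some w then inr w else copy1 (sY G).

(* None is the new edge. *)
Definition step_ends (e : option (edge G + edge G)) :
    step_vertex * step_vertex :=
  match e with
  | None => (copy1 (sX G), copy2 (sY G))
  | Some (inl e1) => (copy1 (ends e1).1, copy1 (ends e1).2)
  | Some (inr e2) => (copy2 (ends e2).1, copy2 (ends e2).2)
  end.

Definition farey_step : special_graph :=
  @SpecialGraph (@Graph step_vertex (option (edge G + edge G)) step_ends)
    (copy1 (sX G)) (copy2 (sY G)).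

End FareyStep.

Definition single_edge : special_graph :=
  @SpecialGraph (@Graph bool unit (fun _ => (false, true))) false true.

Definition farey (n : nat) : special_graph := iter n farey_step single_edge.

Definition T1 (n : nat) : polyxy :=
  \sum_(H : {set edge (farey n)} |
      same_component (G := spanning H) (sX (farey n)) (sY (farey n)))
    tutte_term H.

Definition T2 (n : nat) : polyxy :=
  \sum_(H : {set edge (farey n)} |
      ~~ same_component (G := spanning H) (sX (farey n)) (sY (farey n)))
    tutte_term H.

Definition ratxy : fieldType := {fraction polyxy}.
Definition toratxy (p : polyxy) : ratxy := FracField.tofrac p.

Lemma card_farey_vertex (n : nat) : #|vertex (farey n)| = (2 ^ n + 1)%N.
Proof.
elim: n => [|n IHn]; first by rewrite card_bool.
have c1 : #|[pred v | v != sX (farey n)]| = (2 ^ n)%N.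
  by apply/eqP; rewrite -(eqn_add2l 1) -{1}(card1 (sX (farey n))) cardC IHn addnC.
by rewrite card_sum card_sig -/(farey n) c1 IHn expnS mul2n -addnn addnAC.
Qed.

Lemma card_farey_edge (n : nat) : #|edge (farey n)| = (2 ^ n.+1 - 1)%N.
Proof.
elim: n => [|n IHn]; first by rewrite card_unit.
rewrite card_option card_sum -/(farey n) IHn addnn -mul2n mulnBr -expnS muln1.
have h : (1 < 2 ^ n.+2)%N by rewrite (ltn_exp2l 0).
by rewrite -subSn // subSS.
Qed.

(* Main.v *)
(* A spanning subgraph of G_n is a pair (H1, H2) of spanning subgraphs of     *)
(* G_(n-1), with or without the new edge e_n.  Gluing at one vertex adds up   *)
(* the numbers of components and subtracts 1; adding e_n then subtracts one   *)
(* more unless the special vertices are joined in both H1 and H2.  Hence the  *)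
(* term of (H1, H2) is the product of the terms of H1 and H2, and adding e_n  *)
(* multiplies it by y - 1 if both halves join their special vertices, by      *)
(* 1 / (x - 1) otherwise.                                                     *)

Require Import Defs.
From mathcomp Require Import all_boot all_algebra.
From mathcomp Require Import mpoly.
From mathcomp Require Import zify ring.
Import GRing.Theory fingraph.
Local Open Scope ring_scope.

Set Implicit Arguments.
Unset Strict Implicit.
Unset Printing Implicit Defensive.

(** Because every [farey n] is connected ([farey_connected]), the term of a spanning subgraph H with
    k components is (x-1)^(k-1) (y-1)^(|H|+k-|V|) ([tutte_term_connected]), so only edges and
    components have to be counted. [step_set_bij] turns the sum for the next graph into a sum over
    pairs of halves and one bit for e_n; [components_step0] and [components_step1] count components.

    The special vertices of the result are joined iff e_n is present or both halves join theirs
    ([same_component_step]). They are separated when e_n is absent and some half is separated, which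
    gives T2^2 + 2 T1 T2. They are joined either with both halves joined, where e_n present or
    absent gives the factor 1 + (y-1) = y, or through e_n alone, which gives the previous sum
    divided by x-1. The recursion for T1 is proved in the polynomial ring multiplied by x-1, and
    divided in the fraction field at the end. *)

(** * Counting the components of a symmetric relation *)

Lemma connect_homo (T T' : finType) (e : rel T) (e' : rel T') (f : T -> T') :
  (forall u v, e u v -> connect e' (f u) (f v)) ->
  forall u v, connect e u v -> connect e' (f u) (f v).
Proof.
move=> ee' u v /connectP[p]; elim: p u => [|w p IHp] u /=; first by move=> _ ->.
by case/andP=> /ee' uw wp /(IHp _ wp); apply: connect_trans.
Qed.

Lemma connect_invariant (T : finType) (T' : Type) (e : rel T) (f : T -> T') :
  (forall u v, e u v -> f u = f v) -> forall u v, connect e u v -> f u = f v.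
Proof.
move=> ef u v /connectP[p]; elim: p u => [|w p IHp] u /=; first by move=> _ ->.
by case/andP=> /ef-> wp /(IHp _ wp).
Qed.

(** A complete invariant of connectivity is injective on the roots and takes all its values there.
    Component counts thus become cardinals of explicit images. *)
Lemma n_comp_classifier (T T' : finType) (e : rel T) (f : T -> T') :
  ssrbool.symmetric e -> (forall u v, connect e u v = (f u == f v)) ->
  n_comp e T = #|f @: T|.
Proof.
move=> e_sym fP; have ce := sym_connect_sym e_sym.
have -> : f @: T = f @: [set x | roots e x].
  apply/setP=> z; apply/imsetP/imsetP => -[u _ ->]; last by exists u.
  exists (root e u); first by rewrite inE roots_root.
  by apply/eqP; rewrite -fP connect_root.
rewrite card_in_imset; first by rewrite cardsE; apply: eq_card => x; rewrite !inE andbT.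
move=> u v; rewrite !inE => /eqP ru /eqP rv /eqP; rewrite -fP => /(rootP ce).
by rewrite ru rv.
Qed.

(** Redirecting the root of y to the root of x gives a complete invariant for the enlarged relation;
    its image loses the root of y exactly when the two classes differ. *)
Lemma n_comp_add_edge (T : finType) (e e' : rel T) (x y : T) :
  ssrbool.symmetric e ->
  (forall u v, e' u v = [|| e u v, (x, y) == (u, v) | (x, y) == (v, u)]) ->
  (n_comp e' T + ~~ connect e x y)%N = n_comp e T.
Proof.
move=> e_sym e'E; have ce := sym_connect_sym e_sym.
have e'_sym : ssrbool.symmetric e'.
  by move=> u v; rewrite !e'E e_sym; congr (_ || _); rewrite orbC.
have ce' := sym_connect_sym e'_sym.
pose f u := if root e u == root e y then root e x else root e u.
have sub_ee' : subrel (connect e) (connect e').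
  by apply: connect_sub => u v euv; apply: connect1; rewrite e'E euv.
have xy' : connect e' x y by apply: connect1; rewrite e'E eqxx orbT.
have f_conn u : connect e' u (f u).
  rewrite /f; case: eqP => [/(rootP ce)/sub_ee' uy|_]; last exact/sub_ee'/connect_root.
  by apply: connect_trans uy _; rewrite ce'; apply: connect_trans xy';
     rewrite ce'; apply/sub_ee'/connect_root.
have fxy : f x = f y by rewrite /f eqxx; case: eqP.
have fP u v : connect e' u v = (f u == f v).
  apply/idP/eqP => [|fuv]; last first.
    by apply: connect_trans (f_conn u) _; rewrite fuv ce'.
  apply: connect_invariant u v => u v; rewrite e'E.
  case/or3P=> [/connect1/(rootP ce) ruw | /eqP[<- <-] | /eqP[<- <-]] //.
  by rewrite /f ruw.
rewrite (n_comp_classifier e'_sym fP) (n_comp_classifier (f := root e) e_sym); last first.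
  by move=> u v; apply/(rootP ce)/eqP.
have [/(rootP ce) xy|/(rootP ce)/eqP xy] := boolP (connect e x y).
  rewrite addn0 (@eq_imset _ _ f (root e)) // => u.
  by rewrite /f xy; case: eqP.
rewrite [in RHS](cardsD1 (root e y)) imset_f // addnC; congr (_ + _)%N.
apply: eq_card => z; rewrite !inE; apply/imsetP/andP.
  case=> u _ ->; rewrite /f; case: ifP => [_|->]; first by rewrite xy imset_f.
  by rewrite imset_f.
by case=> zy /imsetP[u _ zu]; exists u => //; rewrite /f -zu (negbTE zy).
Qed.

(** * Components of spanning subgraphs *)

Lemma adj_sym (G : graph) : ssrbool.symmetric (@adj G).
Proof. by move=> u v; apply: eq_existsb => e; rewrite orbC. Qed.

Lemma adj_spanning (G : graph) (H : {set edge G}) (u v : vertex G) :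
  @adj (spanning H) u v =
  [exists e in H, (ends e == (u, v)) || (ends e == (v, u))].
Proof.
apply/existsP/existsP => [[e uv]|[e /andP[He uv]]].
  by exists (val e); rewrite (valP e).
by exists (Sub e He).
Qed.

Lemma card_spanning_edge (G : graph) (H : {set edge G}) :
  #|edge (spanning H)| = #|H|.
Proof. by rewrite card_sig; apply: eq_card. Qed.

Lemma components_setT (G : graph) :
  components (spanning [set: edge G]) = components G.
Proof.
apply: eq_n_comp; apply: eq_connect => u v; rewrite adj_spanning.
by apply: eq_existsb => e; rewrite inE.
Qed.

Lemma components_le_vertex (G : graph) : (components G <= #|vertex G|)%N.
Proof. exact: max_card. Qed.

Lemma components_gt0 (G : graph) (v : vertex G) : (0 < components G)%N.
Proof.
apply/card_gt0P; exists (root (@adj G) v); rewrite !inE.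
by rewrite roots_root //; apply/sym_connect_sym/adj_sym.
Qed.

(** Removing one edge creates at most one new component. This makes the truncated subtraction in the
    exponent of y-1 exact. *)
Lemma vertex_le_components (G : graph) (H : {set edge G}) :
  (#|vertex G| <= components (spanning H) + #|H|)%N.
Proof.
have [n] := ubnP #|H|; elim: n H => // n IHn H.
have [-> _|[e He] Hn] := set_0Vmem H.
  rewrite cards0 addn0 /components (n_comp_classifier (f := id)) ?card_imset //.
    exact: adj_sym.
  move=> u v; apply/connectP/eqP => [[[|w p] /=]|->]; last by exists [::].
    by move=> _ ->.
  by rewrite adj_spanning; case/andP=> /existsP[e]; rewrite inE.
have:= IHn (H :\ e); rewrite (cardsD1 e H) He in Hn *; move/(_ Hn)/leq_trans; apply.
rewrite addnA leq_add2r.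
suff <- : (components (spanning H)
             + ~~ connect (@adj (spanning (H :\ e))) (ends e).1 (ends e).2
           = components (spanning (H :\ e)))%N by rewrite leq_add2l leq_b1.
apply: n_comp_add_edge; first exact: (@adj_sym (spanning (H :\ e))).
move=> u v; rewrite !adj_spanning -!surjective_pairing.
apply/existsP/or3P => [[e1 /andP[He1 uv]]|].
  have [e1e|e1e] := eqVneq e1 e; first by
    case/orP: uv; rewrite e1e; [constructor 2|constructor 3].
  by constructor 1; apply/existsP; exists e1; rewrite !inE e1e He1.
case=> [/existsP[e1]|uv|uv]; try by exists e; rewrite He uv ?orbT.
by rewrite !inE => /andP[/andP[_ He1] uv]; exists e1; rewrite He1.
Qed.

(** * Spanning subgraphs of the glued graph and their components *)

Definition step_set (G : special_graph) (b : bool) (H1 H2 : {set edge G}) :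
    {set edge (farey_step G)} :=
  [set e | match e : option (edge G + edge G) with
           | None => b
           | Some (inl e1) => e1 \in H1
           | Some (inr e2) => e2 \in H2
           end].

Lemma step_set_bij (G : special_graph) :
  bijective (fun p : bool * ({set edge G} * {set edge G}) =>
               step_set p.1 p.2.1 p.2.2).
Proof.
exists (fun H : {set edge (farey_step G)} =>
          (None \in H, ([set e | Some (inl e) \in H],
                        [set e | Some (inr e) \in H]))).
  by move=> [b [H1 H2]] /=; rewrite inE; congr (_, (_, _)); apply/setP=> e; rewrite !inE.
by move=> H; apply/setP=> -[[e|e]|]; rewrite !inE.
Qed.

Lemma card_step_set (G : special_graph) (b : bool) (H1 H2 : {set edge G}) :
  #|step_set b H1 H2| = (#|H1| + #|H2| + b)%N.
Proof.
(* The enumeration of an option type is [None] followed by the [Some] values; unfolding it splits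
   off the contribution of [b]. *)
rewrite -sum1_card [index_enum _]unlock [@Finite.enum in LHS]unlock /= /option_enum.
rewrite big_cons big_map -enumT big_enum_cond /= big_sumType inE.
rewrite (eq_bigl (mem H1)) => [|e]; last by rewrite !inE.
rewrite sum1_card (eq_bigl (mem H2)) => [|e]; last by rewrite !inE.
by rewrite sum1_card; case: b; rewrite ?addn0 // addnC.
Qed.

Section FareyStepSubgraph.
Variables (G : special_graph) (H1 H2 : {set edge G}).

Local Notation S b := (@spanning (farey_step G) (step_set b H1 H2)).
Let c1 := @same_component (spanning H1) (sX G) (sY G).
Let c2 := @same_component (spanning H2) (sX G) (sY G).
Let r1 := root (@adj (spanning H1)).
Let r2 := root (@adj (spanning H2)).

Lemma copy2X : copy2 (sX G) = copy1 (sY G).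
Proof. by rewrite /copy2 insubF // eqxx. Qed.

Lemma copy2_neqX v (vX : v != sX G) : copy2 v = inr (Sub v vX).
Proof. by rewrite /copy2 insubT. Qed.

Lemma adj_step b (u v : step_vertex G) :
  @adj (S b) u v =
  [|| [exists e in H1, ((copy1 (ends e).1, copy1 (ends e).2) == (u, v))
                    || ((copy1 (ends e).1, copy1 (ends e).2) == (v, u))],
      [exists e in H2, ((copy2 (ends e).1, copy2 (ends e).2) == (u, v))
                    || ((copy2 (ends e).1, copy2 (ends e).2) == (v, u))]
    | b && (((copy1 (sX G), copy2 (sY G)) == (u, v))
         || ((copy1 (sX G), copy2 (sY G)) == (v, u)))].
Proof.
rewrite adj_spanning; apply/existsP/or3P.
  case=> -[[e|e]|]; rewrite inE /= => uv.
  - by constructor 1; apply/existsP; exists e.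
  - by constructor 2; apply/existsP; exists e.
  - by constructor 3.
case=> [/existsP[e uv]|/existsP[e uv]|uv].
- by exists (Some (inl e)); rewrite inE.
- by exists (Some (inr e)); rewrite inE.
- by exists None; rewrite inE.
Qed.

Let ce1 := sym_connect_sym (@adj_sym (spanning H1)).
Let ce2 := sym_connect_sym (@adj_sym (spanning H2)).

(* A complete invariant of the components of the glued graph without the new  *)
(* edge: the class of X in the second copy is sent to that of Y in the first. *)
Let glue (u : step_vertex G) : vertex G + vertex G :=
  match u with
  | inl v => inl (r1 v)
  | inr v => if r2 (val v) == r2 (sX G) then inl (r1 (sY G)) else inr (r2 (val v))
  end.

Let glue2 v : glue (copy2 v) =
  if r2 v == r2 (sX G) then inl (r1 (sY G)) else inr (r2 v).
Proof.
have [->|vX] := eqVneq v (sX G); first by rewrite copy2X eqxx.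
by rewrite (copy2_neqX vX).
Qed.

Lemma connect_copy1 b u v :
  connect (@adj (spanning H1)) u v -> connect (@adj (S b)) (copy1 u) (copy1 v).
Proof.
apply: (connect_homo (f := @copy1 G)) => {}u {}v.
rewrite adj_spanning => /existsP[e /andP[He uv]].
apply: connect1; rewrite adj_step; apply/or3P; constructor 1; apply/existsP; exists e.
by rewrite He; case/orP: uv => /eqP->; rewrite eqxx ?orbT.
Qed.

Lemma connect_copy2 b u v :
  connect (@adj (spanning H2)) u v -> connect (@adj (S b)) (copy2 u) (copy2 v).
Proof.
apply: (connect_homo (f := @copy2 G)) => {}u {}v.
rewrite adj_spanning => /existsP[e /andP[He uv]].
apply: connect1; rewrite adj_step; apply/or3P; constructor 2; apply/existsP; exists e.
by rewrite He; case/orP: uv => /eqP->; rewrite eqxx ?orbT.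
Qed.

(** Picks a vertex in the component that a value of [glue] stands for, so that vertices with equal
    [glue] are connected through it. *)
Let unglue (z : vertex G + vertex G) : step_vertex G :=
  match z with inl v => copy1 v | inr v => copy2 v end.

Let glueK u : connect (@adj (S false)) u (unglue (glue u)).
Proof.
case: u => [v|v] /=; first exact/connect_copy1/connect_root.
have -> : inr v = copy2 (val v) by rewrite (copy2_neqX (valP v)); congr inr; apply: val_inj.
case: eqP => [/(rootP ce2) vX|_] /=; last exact/connect_copy2/connect_root.
apply: connect_trans (connect_copy2 _ vX) _.
by rewrite copy2X; apply/connect_copy1/connect_root.
Qed.

Let glueP u v : connect (@adj (S false)) u v = (glue u == glue v).
Proof.
have cS := sym_connect_sym (@adj_sym (S false)).
apply/idP/eqP => [|guv]; last by apply: connect_trans (glueK u) _; rewrite guv cS.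
apply: connect_invariant u v => u v; rewrite adj_step orbF.
have edge1 e : e \in H1 -> glue (copy1 (ends e).1) = glue (copy1 (ends e).2).
  move=> He; congr inl; apply/(rootP ce1)/connect1; rewrite adj_spanning.
  by apply/existsP; exists e; rewrite He -surjective_pairing eqxx.
have edge2 e : e \in H2 -> glue (copy2 (ends e).1) = glue (copy2 (ends e).2).
  move=> He; rewrite !glue2; suff -> : r2 (ends e).1 = r2 (ends e).2 by [].
  apply/(rootP ce2)/connect1; rewrite adj_spanning.
  by apply/existsP; exists e; rewrite He -surjective_pairing eqxx.
by case/orP=> /existsP[e /andP[He]]; case/orP=> /eqP[<- <-];
  rewrite ?(edge1 e) ?(edge2 e).
Qed.

Lemma same_component_step b :
  @same_component (S b) (sX (farey_step G)) (sY (farey_step G)) = b || (c1 && c2).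
Proof.
case: b => /=.
  by apply: connect1; rewrite adj_step eqxx !orbT.
rewrite /same_component glueP glue2 /=.
rewrite /c1 /c2 /same_component -(root_connect ce1) -(root_connect ce2).
rewrite -/r1 -/r2 [r2 (sY G) == _]eq_sym.
by case: (_ == r2 _); rewrite ?andbT ?andbF.
Qed.

(** The image of [glue] is the disjoint union of the roots of the first half and the roots of the
    second half other than that of X, which the gluing absorbs. *)
Lemma components_step0 :
  (components (S false) + 1 = components (spanning H1) + components (spanning H2))%N.
Proof.
rewrite /components (n_comp_classifier (@adj_sym _) glueP).
rewrite (n_comp_classifier (f := r1) (@adj_sym (spanning H1))); last first.
  by move=> u v; rewrite -(root_connect ce1).
rewrite (n_comp_classifier (f := r2) (@adj_sym (spanning H2))); last first.
  by move=> u v; rewrite -(root_connect ce2).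
rewrite [in RHS](cardsD1 (r2 (sX G))) imset_f // addnCA addnC; congr (_ + _)%N.
rewrite -(card_imset (mem (r1 @: _)) (@inl_inj _ (vertex G))).
rewrite -(card_imset (mem (_ :\ _)) (@inr_inj (vertex G) _)).
rewrite -cardsUI [_ :&: _](_ : _ = set0) ?cards0 ?addn0; last first.
  by apply/setP=> z; rewrite !inE; apply/andP => -[/imsetP[u _ ->] /imsetP[]].
apply: eq_card => z; rewrite inE; apply/imsetP/orP.
  case=> -[v|v] _ -> /=; first by left; rewrite !imset_f.
  case: ifP => vX; first by left; rewrite !imset_f.
  by right; rewrite !imset_f // !inE vX imset_f.
case=> /imsetP[w].
  by case/imsetP=> v _ -> ->; exists (copy1 v).
rewrite !inE => /andP[wX /imsetP[v _ wv]] ->.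
by exists (copy2 v); rewrite // glue2 -wv (negbTE wX).
Qed.

Lemma components_step1 :
  (components (S true) + ~~ (c1 && c2) = components (S false))%N.
Proof.
(* Without e_n, [same_component_step] says that [c1 && c2] is connectedness of the two ends of the
   edge being added. *)
rewrite -[c1 && c2]/(false || _) -same_component_step; apply: n_comp_add_edge.
  exact: (@adj_sym (S false)).
by move=> u v; rewrite !adj_step orbF orbA.
Qed.

End FareyStepSubgraph.

(** * Connectedness of the Farey graphs and the Tutte term under gluing *)

(** The full graph is the spanning subgraph made of two full halves and e_n, so the component counts
    for [step_set] apply to it. *)
Lemma farey_connected n :
  components (farey n) = 1%N /\ same_component (sX (farey n)) (sY (farey n)).
Proof.
have setTE (G : special_graph) :
    step_set true [set: edge G] [set: edge G] = [set: edge (farey_step G)].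
  by apply/setP=> -[[e|e]|]; rewrite !inE.
have scT (G : graph) u v : same_component (G := spanning [set: edge G]) u v =
    same_component (G := G) u v.
  apply: eq_connect => {}u {}v; rewrite adj_spanning.
  by apply: eq_existsb => e; rewrite inE.
elim: n => [|n [IHk IHc]].
  have XY : same_component (sX single_edge) (sY single_edge).
    by apply: connect1; apply/existsP; exists tt.
  split=> //; rewrite /components (n_comp_classifier (f := fun=> tt)).
  - rewrite (_ : _ @: _ = [set tt]) ?cards1 //; apply/setP => -[].
    by rewrite !inE; apply/imsetP; exists true.
  - exact: adj_sym.
  move=> u v; rewrite eqxx; have ce := sym_connect_sym (@adj_sym single_edge).
  by case: u v => [] [] //; rewrite ?connect0 // ce.
split; last by rewrite -scT -setTE same_component_step.
rewrite -components_setT -[farey n.+1]/(farey_step (farey n)) -setTE.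
have:= components_step1 [set: edge (farey n)] setT.
have:= components_step0 [set: edge (farey n)] setT.
by rewrite !scT IHc !components_setT IHk; lia.
Qed.

Lemma tutte_term_connected (G : graph) (H : {set edge G}) :
  components G = 1%N ->
  tutte_term H = (xpol - 1) ^+ (components (spanning H)).-1
     * (ypol - 1) ^+ (#|H| + components (spanning H) - #|vertex G|).
Proof.
move=> kG; rewrite /tutte_term /nullity /rank card_spanning_edge kG.
have le1 : (components (spanning H) <= #|vertex G|)%N := components_le_vertex _.
have le2 := vertex_le_components H.
(* A vertex is needed to know that the subgraph has a component, which makes [.-1] exact. *)
have /card_gt0P[v _] : (0 < #|vertex G|)%N by rewrite -kG components_le_vertex.
have k_gt0 := components_gt0 (v : vertex (spanning H)).
by move: le1 le2 => /=; set m := #|vertex G| => le1 le2; congr (_ ^+ _ * _ ^+ _); lia.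
Qed.

Lemma card_step_vertex (G : special_graph) :
  (#|vertex (farey_step G)| + 1 = #|vertex G| + #|vertex G|)%N.
Proof.
rewrite card_sum card_sig -addnA; congr (_ + _)%N.
by rewrite -[RHS](cardC (pred1 (sX G))) card1 addnC.
Qed.

Section FareyStepTerm.
Variables (G : special_graph) (H1 H2 : {set edge G}).
Hypotheses (kG : components G = 1%N) (kS : components (farey_step G) = 1%N).

Let k1_gt0 := components_gt0 (sX G : vertex (spanning H1)).
Let k2_gt0 := components_gt0 (sX G : vertex (spanning H2)).

(** Gluing lowers both the sum of the k's and the sum of the |V|'s by 1, so k-1 and |H|+k-|V| are
    both additive. *)
Lemma tutte_term_step0 :
  tutte_term (step_set false H1 H2) = tutte_term H1 * tutte_term H2.
Proof.
rewrite !tutte_term_connected // mulrACA -!exprD card_step_set.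
have := components_step0 H1 H2; have := card_step_vertex G.
have := vertex_le_components H1; have := vertex_le_components H2.
by move=> *; congr (_ ^+ _ * _ ^+ _); lia.
Qed.

(** If [c] holds, e_n closes a cycle and only the nullity grows. Otherwise it merges two components:
    the nullity stays and the exponent of x-1 drops by one, which the left factor compensates
    without division. *)
Lemma tutte_term_step1 (c := @same_component (spanning H1) (sX G) (sY G)
                          && @same_component (spanning H2) (sX G) (sY G)) :
  (xpol - 1) ^+ (~~ c) * tutte_term (step_set true H1 H2) =
  (ypol - 1) ^+ c * (tutte_term H1 * tutte_term H2).
Proof.
rewrite !tutte_term_connected // mulrA -exprD mulrACA -!exprD mulrCA -exprD.
rewrite card_step_set.
have := components_step1 H1 H2; rewrite -/c.
have := components_step0 H1 H2; have := card_step_vertex G.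
have := vertex_le_components H1; have := vertex_le_components H2.
have := components_gt0 (sX _ : vertex (spanning (step_set true H1 H2))).
by case: c => /= *; congr (_ ^+ _ * _ ^+ _); lia.
Qed.

End FareyStepTerm.

(** * The recursions in the polynomial ring *)

Lemma sum_step_set (G : special_graph) (P : pred {set edge (farey_step G)}) F :
  \sum_(H | P H) F H =
  \sum_(H1 : {set edge G}) \sum_(H2 : {set edge G})
    ((if P (step_set false H1 H2) then F (step_set false H1 H2) else 0)
     + (if P (step_set true H1 H2) then F (step_set true H1 H2) else 0)) :> polyxy.
Proof.
rewrite big_mkcond (reindex _ (onW_bij _ (step_set_bij G))) /=.
rewrite pair_big -(pair_big predT predT (fun b p =>
  if P (step_set b p.1 p.2) then F (step_set b p.1 p.2) else 0)) /=.
by rewrite big_bool -big_split /=; apply: eq_bigr => p _; rewrite addrC.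
Qed.

(** Extending the terms by 0 lets both partial sums range over all edge sets, so their products
    expand into double sums that can be compared pair by pair. *)
Definition term1 n (H : {set edge (farey n)}) :=
  if same_component (G := spanning H) (sX (farey n)) (sY (farey n))
  then tutte_term H else 0.
Definition term2 n (H : {set edge (farey n)}) :=
  if same_component (G := spanning H) (sX (farey n)) (sY (farey n))
  then 0 else tutte_term H.

Lemma T1E n : T1 n = \sum_H @term1 n H.
Proof. by rewrite /T1 big_mkcond. Qed.

Lemma T2E n : T2 n = \sum_H @term2 n H.
Proof. by rewrite /T2 big_mkcond; apply: eq_bigr => H _; rewrite if_neg. Qed.

Lemma T2_step n : T2 n.+1 = T2 n ^+ 2 + 2 * T1 n * T2 n.
Proof.
have [kG _] := farey_connected n; have [kS _] := farey_connected n.+1.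
rewrite [LHS]/T2 (sum_step_set (G := farey n)).
(* The factor 2 is split according to which half separates its special vertices. *)
rewrite [RHS](_ : _ = T2 n * T2 n + (T1 n * T2 n + T2 n * T1 n)); last by ring.
rewrite T1E T2E !big_distrlr /= -!big_split.
apply: eq_bigr => H1 _; rewrite -!big_split; apply: eq_bigr => H2 _ /=.
rewrite !same_component_step /= (tutte_term_step0 _ _ kG kS) addr0 /term1 /term2.
case: (@same_component (spanning H1) _ _);
  case: (@same_component (spanning H2) _ _) => /=;
  by rewrite ?(mul0r, mulr0, add0r, addr0).
Qed.

Lemma T1_step n :
  (xpol - 1) * T1 n.+1 =
  (xpol - 1) * ypol * T1 n ^+ 2 + 2 * T1 n * T2 n + T2 n ^+ 2.
Proof.
have [kG _] := farey_connected n; have [kS _] := farey_connected n.+1.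
rewrite [in LHS]/T1 (sum_step_set (G := farey n)).
rewrite [RHS](_ : _ = (xpol - 1) * ypol * (T1 n * T1 n)
                   + (T1 n * T2 n + T2 n * T1 n + T2 n * T2 n)); last by ring.
rewrite T1E T2E !big_distrlr /= !big_distrr -!big_split.
apply: eq_bigr => H1 _; rewrite !big_distrr -!big_split; apply: eq_bigr => H2 _ /=.
have := tutte_term_step1 H1 H2 kG kS.
rewrite !same_component_step /= (tutte_term_step0 _ _ kG kS) /term1 /term2 mulrDr.
case: (@same_component (spanning H1) _ _);
  case: (@same_component (spanning H2) _ _) => /=;
  rewrite ?expr1 ?expr0 ?mul1r => ->; rewrite ?(mul0r, mulr0, add0r, addr0) //.
(* Both halves joined: the terms without and with e_n add up to 1 + (y-1) = y times the product. *)
by rewrite [(ypol - 1) * _]mulrBl mul1r mulrBr addrC subrK mulrA.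
Qed.

(** * Initial conditions and passage to rational functions *)

Lemma same_component_single_edge (H : {set edge single_edge}) :
  same_component (G := spanning H) (sX single_edge) (sY single_edge) = (tt \in H).
Proof.
apply/idP/idP => [|Htt]; last first.
  by apply: connect1; rewrite adj_spanning; apply/existsP; exists tt; rewrite Htt.
(* Without the edge no vertices are adjacent, so even the identity is constant on components. *)
apply: contraTT => Htt; apply/negP => /(connect_invariant (f := id)) eqXY.
suff : sX single_edge = sY single_edge by [].
apply: eqXY => u v; rewrite adj_spanning => /existsP[[]].
by rewrite (negbTE Htt).
Qed.

Lemma T1_0 : T1 0 = 1.
Proof.
have [kG _] := farey_connected 0.
rewrite /T1 (big_pred1 [set: edge single_edge]) => [|H]; last first.
  rewrite same_component_single_edge; apply/idP/eqP => [Htt|->]; last by rewrite inE.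
  by apply/setP=> -[]; rewrite Htt inE.
rewrite tutte_term_connected // components_setT kG cardsT card_unit card_bool.
by rewrite !expr0 mulr1.
Qed.

Lemma T2_0 : T2 0 = xpol - 1.
Proof.
have [kG _] := farey_connected 0.
rewrite /T2 (big_pred1 (set0 : {set edge single_edge})) => [|H]; last first.
  rewrite same_component_single_edge; apply/idP/eqP => [Htt|->]; last by rewrite inE.
  by apply/setP=> -[]; rewrite (negbTE Htt) inE.
rewrite tutte_term_connected // cards0 card_bool.
have -> : components (spanning (set0 : {set edge single_edge})) = 2%N.
  apply/eqP; rewrite eqn_leq.
  have := vertex_le_components (set0 : {set edge single_edge}).
  have := components_le_vertex (spanning (set0 : {set edge single_edge})).
  by rewrite cards0 addn0 !card_bool => -> ->.
by rewrite expr1 expr0 mulr1.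
Qed.

Lemma T1_step_div (F : fieldType) (a y t t1 t2 : F) : a != 0 ->
  a * t = a * y * t1 ^+ 2 + 2 * t1 * t2 + t2 ^+ 2 ->
  t = y * t1 ^+ 2 + 2 / a * t1 * t2 + 1 / a * t2 ^+ 2.
Proof. by move=> a0 /(canRL (mulKf a0)) ->; field. Qed.

Theorem theorem2 :
  (forall n : nat, (1 <= n)%N ->
    [/\ toratxy (tutte (farey n)) = toratxy (T1 n) + toratxy (T2 n),
        toratxy (T1 n) =
          toratxy ypol * toratxy (T1 n.-1) ^+ 2
          + 2 / (toratxy xpol - 1) * toratxy (T1 n.-1) * toratxy (T2 n.-1)
          + 1 / (toratxy xpol - 1) * toratxy (T2 n.-1) ^+ 2
      & toratxy (T2 n) =
          toratxy (T2 n.-1) ^+ 2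
          + 2 * toratxy (T1 n.-1) * toratxy (T2 n.-1)])
  /\ toratxy (T1 0) = 1
  /\ toratxy (T2 0) = toratxy xpol - 1.
Proof.
rewrite /toratxy; split; last by rewrite T1_0 T2_0 rmorphB rmorph1.
case=> // n _; have x1_neq0 : FracField.tofrac xpol - 1 != 0 :> ratxy.
  rewrite subr_eq0 -(rmorph1 (@FracField.tofrac polyxy)) tofrac_eq.
  (* Evaluation at the origin separates x from 1. *)
  apply/eqP => /(congr1 (meval (fun=> 0))).
  by rewrite mevalXU meval1.
split.
- by rewrite -rmorphD /tutte /T1 /T2 (bigID (fun H : {set edge (farey n.+1)} =>
    same_component (G := spanning H) (sX (farey n.+1)) (sY (farey n.+1)))).
- apply: T1_step_div => //; have := congr1 (@FracField.tofrac polyxy) (T1_step n).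
  by rewrite !rmorphD !(rmorphXn, rmorphM) rmorphB rmorph1 rmorph_nat.
- by rewrite T2_step !rmorphD !(rmorphXn, rmorphM) rmorph_nat.
Qed.
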